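(* Let $R$ be a unital commutative Artinian ring and let $R=\bigoplus_{i=1}^{n}R_i$ be its decomposition into (finitely many) local rings $R_i$. Then $M(R)$ decomposes into the product of the local meadows $M(R_i)$, that is, each $M(R_i)$ is a local common meadow and $M(R)\simeq\prod_{i=1}^{n}M(R_i)$. Moreover this decomposition is unique up to permutation: if $M(R)\simeq\prod_{j=1}^{s}N_j$ with every $N_j$ a local common meadow, then $s=n$ and there is a permutation $\pi$ of $\{1,\dots,n\}$ such that $N_j\simeq M(R_{\pi(j)})$ for all $j$.
   Context: A pre-meadow is a structure $(P,+,-,\cdot)$ with constants $0,1$ such that for all $x,y,z\in P$: $(x+y)+z=x+(y+z)$; $x+y=y+x$; $x+0=x$; $x+(-x)=0\cdot x$; $(x\cdot y)\cdot z=x\cdot(y\cdot z)$; $x\cdot y=y\cdot x$; $1\cdot x=x$; $x\cdot(y+z)=x\cdot y+x\cdot z$; $-(-x)=x$; $0\cdot(x+y)=0\cdot x\cdot y$. Write $0\cdot P=\{0\cdot x\mid x\in P\}$ and, for $z\in 0\cdot P$, $P_z=\{x\in P\mid 0\cdot x=z\}$. $P$ is a pre-meadow with $\mathbf{a}$ if there is a unique $z\in 0\cdot P$ with $|P_z|=1$ (this $z$ is denoted $\mathbf{a}$) and $x+\mathbf{a}=\mathbf{a}$ for all $x\in P$. A common meadow is a pre-meadow with $\mathbf{a}$ equipped with an inverse function $x\mapsto x^{-1}$ satisfying $x\cdot x^{-1}=1+0\cdot x^{-1}$, $(x\cdot y)^{-1}=x^{-1}\cdot y^{-1}$, $(1+0\cdot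 x)^{-1}=1+0\cdot x$, and $0^{-1}=\mathbf{a}$. A homomorphism of common meadows is a map preserving $+$, $\cdot$ and $1$; an isomorphism ($\simeq$) is a bijective homomorphism. Products are Cartesian products with componentwise operations. For a unital commutative ring $R$, $M(R)=\bigsqcup_{I\trianglelefteq R}R/I$ (disjoint union over all ideals $I$ of $R$, including $(0)$ and $R$) with operations $(x+I)+(y+J)=(x+y)+(I+J)$, $(x+I)\cdot(y+J)=(x\cdot y)+(I+J)$, $-(x+I)=-x+I$; its constants are $0=0+(0)$ and $1=1+(0)$, and $\mathbf{a}$ is the unique element of $R/R$. A common meadow (more generally a pre-meadow with $\mathbf{a}$) $P$ is local if $P\neq\{\mathbf{a}\}$ and for all $x,y\in P$, $x+y=\mathbf{a}$ implies $x=\mathbf{a}$ or $y=\mathbf{a}$. A ring is local if it has a unique maximal ideal (so the zero ring is not local). *)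

(* Defs.v *)
From HB Require Import structures.
From mathcomp Require Import all_boot all_order all_algebra.
From mathcomp Require Import ring.
From mathcomp Require Import boolp.

Set Implicit Arguments.
Unset Strict Implicit.
Unset Printing Implicit Defensive.

Import GRing.Theory.
Local Open Scope ring_scope.
Local Open Scope quotient_scope.

Record preMeadow := PreMeadow {
  pm_sort :> Type;
  pm_add : pm_sort -> pm_sort -> pm_sort;
  pm_opp : pm_sort -> pm_sort;
  pm_mul : pm_sort -> pm_sort -> pm_sort;
  pm_zero : pm_sort;
  pm_one : pm_sort;
  pm_addA : associative pm_add;
  pm_addC : commutative pm_add;
  pm_addx0 : right_id pm_zero pm_add;
  pm_addxN : forall x, pm_add x (pm_opp x) = pm_mul pm_zero x;
  pm_mulA : associative pm_mul;
  pm_mulC : commutative pm_mul;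
  pm_mul1x : left_id pm_one pm_mul;
  pm_mulDr : right_distributive pm_mul pm_add;
  pm_oppK : involutive pm_opp;
  pm_mul0D : forall x y,
    pm_mul pm_zero (pm_add x y) = pm_mul (pm_mul pm_zero x) y
}.

Arguments pm_zero {p}.
Arguments pm_one {p}.

Declare Scope meadow_scope.
Delimit Scope meadow_scope with M.
Notation "0" := pm_zero : meadow_scope.
Notation "1" := pm_one : meadow_scope.
Notation "x + y" := (pm_add x y) : meadow_scope.
Notation "- x" := (pm_opp x) : meadow_scope.
Notation "x * y" := (pm_mul x y) : meadow_scope.

(* z \in 0 . P *)
Definition zero_mult (P : preMeadow) (z : P) : Prop :=
  exists x : P, z = (0 * x)%M.

(* x \in P_z *)
Definition pm_fiber (P : preMeadow) (z x : P) : Prop := (0 * x)%M = z.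

(* z \in 0 . P and |P_z| = 1 *)
Definition singleton_level (P : preMeadow) (z : P) : Prop :=
  zero_mult z /\ exists! x : P, pm_fiber z x.

(* The field [pm_a] is determined by [pm_aP]. *)
Record preMeadowA := PreMeadowA {
  pma_base :> preMeadow;
  pm_a : pma_base;
  pm_aP : unique (@singleton_level pma_base) pm_a;
  pm_addxa : forall x : pma_base, (x + pm_a)%M = pm_a
}.

Arguments pm_a {p}.

Record is_inverse (P : preMeadowA) (inv : P -> P) : Prop := IsInverse {
  inv_mul : forall x, (x * inv x = 1 + 0 * inv x)%M;
  inv_M : forall x y, (inv (x * y) = inv x * inv y)%M;
  inv_unit : forall x, (inv (1 + 0 * x) = 1 + 0 * x)%M;
  inv_0 : inv 0%M = pm_a
}.

Record commonMeadow := CommonMeadow {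
  cm_base :> preMeadowA;
  cm_inv : cm_base -> cm_base;
  cm_invP : is_inverse cm_inv
}.

Definition is_common_meadow (P : preMeadowA) : Prop :=
  exists inv : P -> P, is_inverse inv.

Definition local_meadow (P : preMeadowA) : Prop :=
  (exists x : P, x <> pm_a) /\
  forall x y : P, (x + y)%M = pm_a -> x = pm_a \/ y = pm_a.

Record meadow_hom (P Q : preMeadow) (f : P -> Q) : Prop := MeadowHom {
  meadow_homD : {morph f : x y / (x + y)%M >-> (x + y)%M};
  meadow_homM : {morph f : x y / (x * y)%M >-> (x * y)%M};
  meadow_hom1 : f 1%M = 1%M
}.

Definition meadow_iso (P Q : preMeadow) : Prop :=
  exists2 f : P -> Q, meadow_hom f & bijective f.

Section Product.
Variables (I : Type) (P : I -> preMeadow).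
Let T := forall i, P i.

Definition prod_add (x y : T) : T := fun i => (x i + y i)%M.
Definition prod_opp (x : T) : T := fun i => (- x i)%M.
Definition prod_mul (x y : T) : T := fun i => (x i * y i)%M.
Definition prod_zero : T := fun i => 0%M.
Definition prod_one : T := fun i => 1%M.

Lemma prod_addA : associative prod_add.
Proof.
by move=> x y z; apply: functional_extensionality_dep => i; apply: pm_addA.
Qed.
Lemma prod_addC : commutative prod_add.
Proof. by move=> x y; apply: functional_extensionality_dep => i; apply: pm_addC. Qed.
Lemma prod_addx0 : right_id prod_zero prod_add.
Proof. by move=> x; apply: functional_extensionality_dep => i; apply: pm_addx0. Qed.
Lemma prod_addxN x : prod_add x (prod_opp x) = prod_mul prod_zero x.
Proof. by apply: functional_extensionality_dep => i; apply: pm_addxN. Qed.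
Lemma prod_mulA : associative prod_mul.
Proof.
by move=> x y z; apply: functional_extensionality_dep => i; apply: pm_mulA.
Qed.
Lemma prod_mulC : commutative prod_mul.
Proof. by move=> x y; apply: functional_extensionality_dep => i; apply: pm_mulC. Qed.
Lemma prod_mul1x : left_id prod_one prod_mul.
Proof. by move=> x; apply: functional_extensionality_dep => i; apply: pm_mul1x. Qed.
Lemma prod_mulDr : right_distributive prod_mul prod_add.
Proof.
by move=> x y z; apply: functional_extensionality_dep => i; apply: pm_mulDr.
Qed.
Lemma prod_oppK : involutive prod_opp.
Proof. by move=> x; apply: functional_extensionality_dep => i; apply: pm_oppK. Qed.
Lemma prod_mul0D x y :
  prod_mul prod_zero (prod_add x y) = prod_mul (prod_mul prod_zero x) y.
Proof. by apply: functional_extensionality_dep => i; apply: pm_mul0D. Qed.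

Definition prod_meadow : preMeadow :=
  PreMeadow prod_addA prod_addC prod_addx0 prod_addxN prod_mulA prod_mulC
    prod_mul1x prod_mulDr prod_oppK prod_mul0D.

End Product.

(* MathComp's [idealr] only covers proper ideals of nonzero rings, whereas
   M(R) also involves the ideal R itself, hence this record.  Membership is
   boolean so that the library quotient [{ideal_quot I}] applies; by [boolp] every
   subset is of this form. *)
Definition ideal_axiom (R : comPzRingType) (S : {pred R}) : Prop :=
  [/\ 0 \in S, {in S &, forall x y, x + y \in S}
    & forall a, {in S, forall x, a * x \in S}].

Record ideal (R : comPzRingType) := Ideal {
  ideal_pred :> R -> bool;
  ideal_axiomP : ideal_axiom ideal_pred
}.

Section IdealTheory.
Variable R : comPzRingType.
Implicit Types I J K : ideal R.

Lemma ideal_zmod_closed I : zmod_closed (ideal_pred I).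
Proof.
case: (ideal_axiomP I) => I0 ID IM; split=> // x y Ix Iy.
by apply: ID => //; rewrite -mulN1r; apply: IM.
Qed.

HB.instance Definition _ I :=
  GRing.isZmodClosed.Build R (ideal_pred I) (ideal_zmod_closed I).

Coercion ideal_zmodClosed I : zmodClosed R := GRing.ZmodClosed.clone R (ideal_pred I) _.

Lemma idealMl I a x : x \in (I : pred R) -> a * x \in (I : pred R).
Proof. by case: (ideal_axiomP I) => _ _ IM; apply: IM. Qed.

Lemma idealP I J :
  (forall x, (x \in (I : pred R)) = (x \in (J : pred R))) -> I = J.
Proof.
case: I J => [I PI] [J PJ] /= eqIJ.
have {}eqIJ : I = J by apply/funext => x; apply: eqIJ.
by subst J; congr Ideal; apply: Prop_irrelevance.
Qed.

Lemma ideal0_axiom : ideal_axiom (pred1 (0 : R)).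
Proof.
split=> [|x y|a x]; rewrite !inE // => /eqP->; first by rewrite add0r.
by rewrite mulr0.
Qed.
Definition ideal0 : ideal R := Ideal ideal0_axiom.

Lemma idealT_axiom : ideal_axiom (@predT R).
Proof. by []. Qed.
Definition idealT : ideal R := Ideal idealT_axiom.

Definition idealD_pred I J (z : R) : bool :=
  `[< exists x y, [/\ x \in (I : pred R), y \in (J : pred R) & z = x + y] >].

Lemma idealD_axiom I J : ideal_axiom (idealD_pred I J).
Proof.
split=> [|z z'|a z].
- by apply/asboolP; exists 0, 0; rewrite !rpred0 addr0.
- move=> /asboolP[x [y [Ix Jy ->]]] /asboolP[x' [y' [Ix' Jy' ->]]].
  by apply/asboolP; exists (x + x'), (y + y'); rewrite !rpredD // addrACA.
- move=> /asboolP[x [y [Ix Jy ->]]].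
  by apply/asboolP; exists (a * x), (a * y); rewrite !idealMl // mulrDr.
Qed.
Definition idealD I J : ideal R := Ideal (idealD_axiom I J).

Lemma mem_idealD I J z :
  reflect (exists x y, [/\ x \in (I : pred R), y \in (J : pred R) & z = x + y])
          (z \in (idealD I J : pred R)).
Proof. exact: asboolP. Qed.

Lemma idealDC : commutative idealD.
Proof.
by move=> I J; apply: idealP => z; apply/mem_idealD/mem_idealD => -[x [y [? ? ->]]];
  exists y, x; rewrite addrC.
Qed.

Lemma idealDA : associative idealD.
Proof.
move=> I J K; apply: idealP => z; apply/mem_idealD/mem_idealD.
- move=> [x [_ [Ix /mem_idealD[y [w [Jy Kw ->]]] ->]]].
  exists (x + y), w; rewrite addrA; split=> //.
  by apply/mem_idealD; exists x, y.
- move=> [_ [w [/mem_idealD[x [y [Ix Jy ->]]] Kw ->]]].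
  exists x, (y + w); rewrite addrA; split=> //.
  by apply/mem_idealD; exists y, w.
Qed.

Lemma idealDx0 : right_id ideal0 idealD.
Proof.
move=> I; apply: idealP => z; apply/mem_idealD/idP.
- by move=> [x [y [Ix /eqP-> ->]]]; rewrite addr0.
- by move=> Iz; exists z, 0; rewrite addr0 rpred0.
Qed.

Lemma ideal0D : left_id ideal0 idealD.
Proof. by move=> I; rewrite idealDC idealDx0. Qed.

Lemma idealDI : idempotent_op idealD.
Proof.
move=> I; apply: idealP => z; apply/mem_idealD/idP.
- by move=> [x [y [Ix Iy ->]]]; rewrite rpredD.
- by move=> Iz; exists z, 0; rewrite addr0 rpred0.
Qed.

Lemma idealDT I : idealD I idealT = idealT.
Proof.
apply: idealP => z; transitivity true => //; apply/mem_idealD.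
by exists 0, z; rewrite add0r rpred0.
Qed.

Lemma idealDl I J x : x \in (I : pred R) -> x \in (idealD I J : pred R).
Proof. by move=> Ix; apply/mem_idealD; exists x, 0; rewrite addr0 rpred0. Qed.

Lemma idealDr I J x : x \in (J : pred R) -> x \in (idealD I J : pred R).
Proof. by rewrite idealDC; apply: idealDl. Qed.

End IdealTheory.

Definition ideal_sub (R : comPzRingType) (I J : ideal R) : Prop :=
  {subset (I : pred R) <= (J : pred R)}.

Definition artinian (R : comPzRingType) : Prop :=
  forall I : nat -> ideal R, (forall k, ideal_sub (I k.+1) (I k)) ->
  exists m, forall k, (m <= k)%N -> I k = I m.

Definition maximal_ideal (R : comPzRingType) (m : ideal R) : Prop :=
  m <> idealT R /\
  forall J : ideal R, ideal_sub m J -> J <> idealT R -> J = m.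

Definition local_ring (R : comPzRingType) : Prop :=
  exists! m : ideal R, maximal_ideal m.

Section IdealMeadow.
Variable R : comPzRingType.
Implicit Types I J K : ideal R.

Definition mcarrier : Type := {I : ideal R & {ideal_quot I}}.

Definition mclass I (x : R) : mcarrier :=
  Tagged (fun I => {ideal_quot I}) (\pi_{ideal_quot I} x).

Lemma mclassP (u : mcarrier) : u = mclass (tag u) (repr (tagged u)).
Proof. by case: u => I x; rewrite /mclass /= reprK. Qed.

Lemma mclass_eq I J x y :
  mclass I x = mclass J y <-> I = J /\ x - y \in (I : pred R).
Proof.
split=> [eqxy|[<-]]; last first.
  by rewrite Quotient.idealrBE => /eqP eqxy; rewrite /mclass eqxy.
have eqIJ : I = J by exact: (congr1 tag eqxy).
subst J; split=> //; rewrite Quotient.idealrBE; apply/eqP.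
have eq_tagged (u v : mcarrier) (e : u = v) :
    eq_rect _ (fun I => {ideal_quot I}) (tagged u) _ (congr1 tag e) = tagged v.
  by case: v / e.
move: (eq_tagged _ _ eqxy) => /=; move: (congr1 _ _) => /= e.
by rewrite (Prop_irrelevance e erefl).
Qed.

(* Computed on the canonical representatives; [maddE], [moppE] and [mmulE]
   show that the representatives do not matter. *)
Definition madd (u v : mcarrier) : mcarrier :=
  mclass (idealD (tag u) (tag v)) (repr (tagged u) + repr (tagged v)).
Definition mopp (u : mcarrier) : mcarrier :=
  mclass (tag u) (- repr (tagged u)).
Definition mmul (u v : mcarrier) : mcarrier :=
  mclass (idealD (tag u) (tag v)) (repr (tagged u) * repr (tagged v)).
Definition mzero : mcarrier := mclass (ideal0 R) 0.
Definition mone : mcarrier := mclass (ideal0 R) 1.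
Definition ma : mcarrier := mclass (idealT R) 0.

Lemma mrepr I x : repr (\pi_{ideal_quot I} x) - x \in (I : pred R).
Proof. by rewrite Quotient.idealrBE reprK. Qed.

Lemma maddE I J x y : madd (mclass I x) (mclass J y) = mclass (idealD I J) (x + y).
Proof.
apply/mclass_eq; split=> //=; apply/mem_idealD.
exists (repr (\pi_{ideal_quot I} x) - x), (repr (\pi_{ideal_quot J} y) - y).
by rewrite !mrepr; split=> //; rewrite opprD addrACA.
Qed.

Lemma moppE I x : mopp (mclass I x) = mclass I (- x).
Proof. by apply/mclass_eq; split=> //=; rewrite -opprD rpredN mrepr. Qed.

Lemma mmulE I J x y : mmul (mclass I x) (mclass J y) = mclass (idealD I J) (x * y).
Proof.
apply/mclass_eq; split=> //=; apply/mem_idealD.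
set x' := repr _; set y' := repr _.
exists (y' * (x' - x)), (x * (y' - y)).
by rewrite !idealMl ?mrepr //; split=> //; ring.
Qed.

Lemma maddA : associative madd.
Proof.
move=> u v w; rewrite (mclassP u) (mclassP v) (mclassP w).
by rewrite !maddE idealDA addrA.
Qed.

Lemma maddC : commutative madd.
Proof.
by move=> u v; rewrite (mclassP u) (mclassP v) !maddE idealDC addrC.
Qed.

Lemma maddx0 : right_id mzero madd.
Proof. by move=> u; rewrite (mclassP u) maddE idealDx0 addr0. Qed.

Lemma mmul0E I x : mmul mzero (mclass I x) = mclass I 0.
Proof. by rewrite mmulE ideal0D mul0r. Qed.

Lemma maddxN u : madd u (mopp u) = mmul mzero u.
Proof. by rewrite (mclassP u) moppE maddE mmul0E idealDI subrr. Qed.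

Lemma mmulA : associative mmul.
Proof.
move=> u v w; rewrite (mclassP u) (mclassP v) (mclassP w).
by rewrite !mmulE idealDA mulrA.
Qed.

Lemma mmulC : commutative mmul.
Proof.
by move=> u v; rewrite (mclassP u) (mclassP v) !mmulE idealDC mulrC.
Qed.

Lemma mmul1x : left_id mone mmul.
Proof. by move=> u; rewrite (mclassP u) mmulE ideal0D mul1r. Qed.

Lemma mmulDr : right_distributive mmul madd.
Proof.
move=> u v w; rewrite (mclassP u) (mclassP v) (mclassP w).
rewrite !(mmulE, maddE) mulrDr; congr mclass.
set I := tag u; set J := tag v; set K := tag w.
rewrite -{1}(idealDI I) -!idealDA; congr idealD.
by rewrite idealDA (idealDC I J) -idealDA.
Qed.

Lemma moppK : involutive mopp.
Proof. by move=> u; rewrite (mclassP u) !moppE opprK. Qed.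

Lemma mmul0D u v : mmul mzero (madd u v) = mmul (mmul mzero u) v.
Proof.
rewrite (mclassP u) (mclassP v) maddE !mmul0E mmulE.
by rewrite mul0r.
Qed.

Definition ideal_preMeadow : preMeadow :=
  PreMeadow maddA maddC maddx0 maddxN mmulA mmulC mmul1x mmulDr moppK mmul0D.

Lemma maP : unique (@singleton_level ideal_preMeadow) (ma : ideal_preMeadow).
Proof.
split.
  split; first by exists ma; rewrite /= mmul0E.
  exists ma; split; first by rewrite /pm_fiber /= mmul0E.
  move=> u; rewrite /pm_fiber /= {1}(mclassP u) mmul0E => /mclass_eq[eqI _].
  by rewrite (mclassP u); apply/mclass_eq; split=> //; rewrite eqI.
move=> z [[u ->] [v [_ uniqv]]].
move: uniqv; rewrite (mclassP u); set I := tag u; set x := repr _ => uniqv.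
have fiber y : pm_fiber (0 * (mclass I x : ideal_preMeadow))%M
                        (mclass I y : ideal_preMeadow).
  by rewrite /pm_fiber /= !mmul0E.
have /mclass_eq[_] := etrans (esym (uniqv _ (fiber 1))) (uniqv _ (fiber 0)).
rewrite subr0 => I1; rewrite /= mmul0E; apply/mclass_eq; rewrite subrr; split=> //.
by apply: idealP => y; rewrite -[y]mulr1 [RHS]idealMl.
Qed.

Lemma maddxa (u : ideal_preMeadow) : (u + (ma : ideal_preMeadow))%M = ma.
Proof. by rewrite /= (mclassP u) maddE idealDT; apply/mclass_eq. Qed.

Definition ideal_meadow : preMeadowA := PreMeadowA maP maddxa.

End IdealMeadow.

(* Main.v *)
Require Import Defs.
From mathcomp Require Import all_boot all_order all_algebra perm.
From mathcomp Require Import ring boolp.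
From mathcomp Require classical_sets.

Set Implicit Arguments.
Unset Strict Implicit.
Unset Printing Implicit Defensive.

Import GRing.Theory.
Local Open Scope ring_scope.

(** The two halves of the theorem are independent of each other.

    Existence. Every ideal of a finite product of rings is the product of its
    projections (multiply by the coordinate idempotents), so an ideal of [R]
    together with a class modulo it is the same thing as a family of ideals of
    the [R_ i] with a class modulo each: this is [ideal_meadow_prod]. For a local
    ring with maximal ideal [m], every ideal is either the whole ring or inside
    [m] ([local_ideal_dichotomy], by Zorn's lemma). As a sum of two ideals
    inside [m] stays inside [m], the meadow is local. The same dichotomy yields
    the inverse: a unit of [R/I] is inverted in [R/I], and any other class is
    sent to [a].

    Uniqueness. It holds for local pre-meadows with [a] in general
    ([local_factors_unique]), because the factors can be recovered from the
    operations of the product. Inside a product of local factors, let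
    [coord_level i] be the element equal to [0] in coordinate [i] and to [a]
    elsewhere. Adding it to [x] forgets every coordinate of [x] except the
    [i]-th one, so [coord_level i + P] is a copy of the [i]-th factor with unit
    [1 + coord_level i]. The elements [coord_level i] are exactly those
    satisfying [local_component], a condition that mentions only the operations
    and is therefore preserved by isomorphisms ([local_componentP],
    [local_component_coord]). An isomorphism between two products of local
    factors thus matches the elements [coord_level i] bijectively, and with
    them the factors. *)

(** * Complemented levels and isomorphisms of pre-meadows *)

Section PreMeadowTheory.
Variable P : preMeadow.
Implicit Types x y u v w : P.

Lemma pm_add0x x : (0 + x = x)%M.
Proof. by rewrite pm_addC pm_addx0. Qed.

Lemma pm_mul00 : (0 * 0 = 0 :> P)%M.
Proof.
have := pm_mul0D (1 : P)%M 0%M.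
by rewrite pm_addx0 -pm_mulA pm_mul1x pm_mulC pm_mul1x => <-.
Qed.

Lemma pm_mul00x x : (0 * (0 * x) = 0 * x)%M.
Proof. by rewrite pm_mulA pm_mul00. Qed.

Lemma pm_level_idem u : (0 * u = u -> u + u = u)%M.
Proof.
by move=> <-; rewrite -[(0 * u)%M]pm_mulC -pm_mulDr pm_addx0.
Qed.

Definition absorbing u := forall x, (x + u = u)%M.

(** Complements in the semilattice of levels, where [+] is the join, [0] the
    bottom and an absorbing element the top. Two levels have no given meet, so
    that the meet is [0] is expressed through the common lower bounds. *)
Definition complementary u v :=
  [/\ (0 * u = u)%M, (0 * v = v)%M, absorbing (u + v)%M
    & forall w, (0 * w = w -> w + u = u -> w + v = v -> w = 0)%M].

(** A complemented level [u] such that the quotient meadow [u + P] is local.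
    The top is described as an absorbing element, and no reference is made to
    any given product decomposition; hence the notion is invariant under
    isomorphisms. *)
Definition local_component u :=
  [/\ ~ absorbing u, exists v, complementary u v
    & forall x y, absorbing (x + y + u)%M ->
        absorbing (x + u)%M \/ absorbing (y + u)%M].

End PreMeadowTheory.

Section PreMeadowATheory.
Variable P : preMeadowA.

Lemma pm_level_a : (0 * pm_a = pm_a :> P)%M.
Proof. by case: (pm_aP P) => -[[z ->] _] _; rewrite pm_mul00x. Qed.

Lemma pm_addax (x : P) : (pm_a + x = pm_a)%M.
Proof. by rewrite pm_addC pm_addxa. Qed.

Lemma pm_mulaa : (pm_a * pm_a = pm_a :> P)%M.
Proof.
by have := pm_mul0D (pm_a : P) pm_a; rewrite pm_addxa !pm_level_a => {3}->.
Qed.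

Lemma local_meadow_0a : local_meadow P -> 0%M <> pm_a :> P.
Proof. by move=> [[x xa] _] eq0a; apply: xa; rewrite -(pm_addxa x) -eq0a pm_addx0. Qed.

End PreMeadowATheory.

Lemma bijective_of_inj_surj (A B : Type) (f : A -> B) :
  injective f -> (forall y, exists x, f x = y) -> bijective f.
Proof.
move=> f_inj /choice[g fgK]; exists g => // x.
by apply: f_inj; rewrite fgK.
Qed.

Section Isomorphism.
Variables P Q : preMeadow.

Lemma meadow_hom_inv (f : P -> Q) g :
  meadow_hom f -> cancel f g -> cancel g f -> meadow_hom g.
Proof.
move=> [fD fM f1] fK gK; split=> [x y|x y|]; apply: (can_inj fK).
- by rewrite fD !gK.
- by rewrite fM !gK.
- by rewrite f1 gK.
Qed.

Section Transport.
Variables (f : P -> Q) (g : Q -> P).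
Hypotheses (f_hom : meadow_hom f) (fK : cancel f g) (gK : cancel g f).

Let fD := meadow_homD f_hom.
Let fM := meadow_homM f_hom.
Let g_hom := meadow_hom_inv f_hom fK gK.
Let gD := meadow_homD g_hom.

Lemma meadow_hom0 : (f 0 = 0)%M.
Proof. by rewrite -[LHS]pm_addx0 -[X in (f 0 + X)%M]gK -fD pm_add0x gK. Qed.

Lemma absorbing_iso u : absorbing (f u) <-> absorbing u.
Proof.
split=> abs_u x; last by rewrite -[x]gK -fD abs_u.
by apply: (can_inj fK); rewrite fD abs_u.
Qed.

Lemma local_component_iso u : local_component u -> local_component (f u).
Proof.
move=> [nabs_u [v [u0 v0 abs_uv disj]] loc_u]; split.
- by rewrite absorbing_iso.
- exists (f v); split; rewrite -?meadow_hom0 -?fM ?u0 ?v0 //.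
    by rewrite -fD absorbing_iso.
  move=> w; rewrite -[w]gK -fM -!fD.
  by move=> /(can_inj fK)? /(can_inj fK)? /(can_inj fK)?; congr f; apply: disj.
- move=> x y; rewrite -[x]gK -[y]gK -!fD !absorbing_iso; exact: loc_u.
Qed.

End Transport.
End Isomorphism.

Lemma meadow_iso_sym (P Q : preMeadow) : meadow_iso P Q -> meadow_iso Q P.
Proof.
move=> [f f_hom [g fK gK]]; exists g; last by exists f.
exact: meadow_hom_inv f_hom fK gK.
Qed.

Lemma meadow_iso_trans (P Q T : preMeadow) :
  meadow_iso P Q -> meadow_iso Q T -> meadow_iso P T.
Proof.
move=> [f [fD fM f1] f_bij] [g [gD gM g1] g_bij].
exists (g \o f); last exact: bij_comp.
by split=> [x y|x y|] /=; rewrite ?fD ?fM ?f1.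
Qed.

(** * The coordinates of a product of local pre-meadows *)

Section ProductOfLocals.
Variables (I : eqType) (P : I -> preMeadowA).
Hypothesis P_local : forall i, local_meadow (P i).

Notation prodP := (prod_meadow (fun i => P i)).

Definition prod_a : prodP := fun i => pm_a.

Definition coord_level (i : I) : prodP := dfwith prod_a (0%M : P i).

Definition coord_colevel (i : I) : prodP :=
  dfwith (0%M : prodP) (pm_a : P i).

Lemma absorbing_prod (c : prodP) : absorbing c <-> forall i, c i = pm_a.
Proof.
split=> [abs_c i|ca x].
  by rewrite -(abs_c prod_a) /= /prod_add /prod_a pm_addax.
by apply: functional_extensionality_dep => i; rewrite /= /prod_add ca pm_addxa.
Qed.

Lemma add_coord_level i (x : prodP) : (x + coord_level i)%M = dfwith prod_a (x i).
Proof.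
apply: functional_extensionality_dep => j; rewrite /= /prod_add /coord_level.
case: (eqVneq i j) => [<-|ij]; first by rewrite !dfwith_in pm_addx0.
by rewrite !dfwith_out // pm_addxa.
Qed.

Lemma absorbing_add_coord_level i (x : prodP) :
  absorbing (x + coord_level i)%M <-> x i = pm_a.
Proof.
rewrite absorbing_prod add_coord_level; split=> [/(_ i)|xa j].
  by rewrite dfwith_in.
by case: dfwithP.
Qed.

Lemma coord_level_inj : injective coord_level.
Proof.
move=> i j /(congr1 (fun u : prodP => u j)); rewrite /coord_level dfwith_in.
case: eqVneq (dfwith_out prod_a (0%M : P i) (j := j)) => // ij -> //.
by move=> /esym/local_meadow_0a; case.
Qed.

Lemma complementary_coord i : complementary (coord_level i) (coord_colevel i).
Proof.
split.
- apply: functional_extensionality_dep => j; rewrite /= /prod_mul /coord_level.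
  by case: dfwithP => [|k _]; rewrite ?pm_mul00 ?pm_level_a.
- apply: functional_extensionality_dep => j; rewrite /= /prod_mul /coord_colevel.
  by case: dfwithP => [|k _]; rewrite ?pm_mul00 ?pm_level_a.
- rewrite absorbing_prod => j; rewrite /= /prod_add /coord_level /coord_colevel.
  case: (eqVneq i j) => [<-|ij]; first by rewrite !dfwith_in pm_addxa.
  by rewrite !dfwith_out // pm_addax.
- move=> w _ wu wv; apply: functional_extensionality_dep => j.
  case: (eqVneq i j) => [<-|ij].
    have := congr1 (fun u : prodP => u i) wu.
    by rewrite /= /prod_add /coord_level dfwith_in pm_addx0.
  have := congr1 (fun u : prodP => u j) wv.
  by rewrite /= /prod_add /coord_colevel dfwith_out //= pm_addx0.
Qed.

Lemma local_component_coord i : local_component (coord_level i).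
Proof.
split; last 1 first.
- by move=> x y; rewrite !absorbing_add_coord_level; apply: (P_local i).2.
- rewrite absorbing_prod => /(_ i); rewrite /coord_level dfwith_in.
  exact: local_meadow_0a.
- by exists (coord_colevel i); apply: complementary_coord.
Qed.

(** Locality of the factors forces a complemented level to have all its
    coordinates in [{0, a}]: in each coordinate [u] or [v] is [a], and then the
    other one, being a lower bound of both, is [0]. *)
Lemma complementary_coords (u v : prodP) i :
  complementary u v -> u i = 0%M \/ u i = pm_a.
Proof.
move=> [u0 v0 /absorbing_prod/(_ i) uv disj].
have [|via] := (P_local i).2 _ _ uv; [by right|left].
(* [w] is a lower bound of [u], and one of [v] because [v i = a]. *)
pose w : prodP := dfwith (0%M : prodP) (u i).
suff w0 : w = 0%M by rewrite -[u i](dfwith_in (0%M : prodP)) -/w w0.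
have uii : (u i + u i = u i)%M.
  exact: pm_level_idem (congr1 (fun c : prodP => c i) u0).
apply: disj; apply: functional_extensionality_dep => j;
  rewrite /= /prod_add /prod_mul /w; case: dfwithP => [|k _] /=;
  rewrite ?pm_mul00 ?pm_add0x ?via ?pm_addxa //.
exact: (congr1 (fun c : prodP => c i) u0).
Qed.

(** Two coordinates of [u] equal to [0] could be separated by a pair of
    complementary levels, against the locality of [u]. *)
Lemma local_componentP (u : prodP) :
  local_component u -> exists i, u = coord_level i.
Proof.
move=> [nabs_u [v uv] loc_u].
have [i uia] : exists i, u i <> pm_a.
  by apply/existsNP => ua; apply: nabs_u; rewrite absorbing_prod.
have ui0 : u i = 0%M by case: (complementary_coords i uv).
have [_ _ abs_i _] := complementary_coord i.
exists i; apply: functional_extensionality_dep => j.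
rewrite /coord_level; case: (eqVneq i j) => [<-|ij]; first by rewrite dfwith_in.
rewrite dfwith_out //.
have abs_iu : absorbing (coord_level i + coord_colevel i + u)%M.
  by rewrite pm_addC => x; rewrite abs_i abs_i.
have [] := loc_u _ _ abs_iu => /absorbing_prod.
  move=> /(_ i); rewrite /= /prod_add ui0 pm_addx0 /coord_level dfwith_in.
  by move/local_meadow_0a; case.
by move=> /(_ j); rewrite /= /prod_add /coord_colevel dfwith_out //= pm_add0x.
Qed.

End ProductOfLocals.

(** * Uniqueness of the local factors *)

Section Uniqueness.
Variables (I J : eqType) (P : I -> preMeadowA) (Q : J -> preMeadowA).
Hypothesis P_local : forall i, local_meadow (P i).
Hypothesis Q_local : forall j, local_meadow (Q j).

Notation prodP := (prod_meadow (fun i => P i)).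
Notation prodQ := (prod_meadow (fun j => Q j)).

(** The factor [P i] sits in the product as the ideal [coord_level i + prodP],
    which an isomorphism carries to the corresponding ideal of [prodQ]. *)
Lemma coord_factor_iso (f : prodP -> prodQ) (g : prodQ -> prodP) i j :
  meadow_hom f -> cancel f g -> cancel g f ->
  f (coord_level P i) = coord_level Q j -> meadow_iso (P i) (Q j).
Proof.
move=> f_hom fK gK fij; have [fD fM f1] := f_hom.
have g_hom := meadow_hom_inv f_hom fK gK; have [gD _ _] := g_hom.
pose inP (x : P i) : prodP := dfwith (prod_a P) x.
pose inQ (y : Q j) : prodQ := dfwith (prod_a Q) y.
have fE x : f (inP x) = inQ (f (inP x) j).
  rewrite /inQ -add_coord_level -fij -fD add_coord_level.
  by rewrite /inP dfwith_in.
have gE y : g (inQ y) = inP (g (inQ y) i).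
  rewrite /inP -add_coord_level -(fK (coord_level P i)) fij -gD add_coord_level.
  by rewrite /inQ dfwith_in.
exists (fun x => f (inP x) j); last first.
  exists (fun y => g (inQ y) i) => [x|y].
    by rewrite -fE fK /inP dfwith_in.
  by rewrite -gE gK /inQ dfwith_in.
split=> [x y|x y|].
- suff -> : inP (x + y)%M = (inP x + inP y)%M by rewrite fD.
  apply: functional_extensionality_dep => k; rewrite /= /prod_add /inP.
  case: (eqVneq i k) => [<-|ik]; first by rewrite !dfwith_in.
  by rewrite !dfwith_out // pm_addxa.
- suff -> : inP (x * y)%M = (inP x * inP y)%M by rewrite fM.
  apply: functional_extensionality_dep => k; rewrite /= /prod_mul /inP.
  case: (eqVneq i k) => [<-|ik]; first by rewrite !dfwith_in.
  by rewrite !dfwith_out // pm_mulaa.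
- have -> : inP 1%M = (1 + coord_level P i)%M by rewrite add_coord_level.
  by rewrite fD f1 fij add_coord_level dfwith_in.
Qed.

Lemma local_factors_unique : meadow_iso prodP prodQ ->
  exists sigma : I -> J,
    bijective sigma /\ forall i, meadow_iso (P i) (Q (sigma i)).
Proof.
move=> [f f_hom [g fK gK]].
have g_hom := meadow_hom_inv f_hom fK gK.
have /choice[sigma fs] i : exists j, f (coord_level P i) = coord_level Q j.
  apply/(local_componentP Q_local)/(local_component_iso f_hom fK gK).
  exact: local_component_coord.
have /choice[tau gt] j : exists i, g (coord_level Q j) = coord_level P i.
  apply/(local_componentP P_local)/(local_component_iso g_hom gK fK).
  exact: local_component_coord.
exists sigma; split; last by move=> i; apply: (coord_factor_iso f_hom fK gK).
exists tau => [i|j].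
  by apply: (coord_level_inj P_local); rewrite -gt -fs fK.
by apply: (coord_level_inj Q_local); rewrite -fs -gt gK.
Qed.

End Uniqueness.

(** * The meadow of ideals of a local ring *)

Section LocalRings.
Variable S : comPzRingType.
Implicit Types (I J : ideal S) (x y z : S).

Lemma ideal1T I : 1 \in (I : pred S) -> I = idealT S.
Proof. by move=> I1; apply: idealP => x; rewrite -[x]mulr1 [LHS]idealMl. Qed.

Lemma proper_ideal1 I : I <> idealT S -> 1 \notin (I : pred S).
Proof. by move=> IT; apply/negP => /ideal1T. Qed.

Lemma idealD_sub I J K :
  ideal_sub I K -> ideal_sub J K -> ideal_sub (idealD I J) K.
Proof.
by move=> IK JK _ /mem_idealD[x [y [/IK Kx /JK Ky ->]]]; rewrite rpredD.
Qed.

Lemma principal_axiom x : ideal_axiom (fun z => `[< exists y, z = x * y >]).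
Proof.
split=> [|_ _ /asboolP[y ->] /asboolP[z ->]|a _ /asboolP[y ->]]; apply/asboolP.
- by exists 0; rewrite mulr0.
- by exists (y + z); rewrite mulrDr.
- by exists (a * y); rewrite mulrCA.
Qed.

Definition principal_ideal x : ideal S := Ideal (principal_axiom x).

Lemma exists_maximal_ideal I :
  I <> idealT S -> exists2 m, maximal_ideal m & ideal_sub I m.
Proof.
move=> /proper_ideal1 Iproper.
(* Adjoining [I] to the sets under consideration makes the union of the empty
   chain admissible. *)
pose D (A : S -> Prop) x := x \in (I : pred S) \/ A x.
pose adm A := exists2 J : ideal S, 1 \notin (J : pred S) &
  forall x, D A x <-> x \in (J : pred S).
have [F Fadm Ftot|A [[J J1 AJ] Amax]] := @classical_sets.Zorn_bigcup S adm.
  pose U x := exists2 A : S -> Prop, F A & A x.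
  have cmp2 x y : D U x -> D U y ->
      x \in (I : pred S) /\ y \in (I : pred S) \/ exists A, [/\ F A, D A x & D A y].
    move=> [Ix|[A FA Ax]] [Iy|[B FB By]]; first by left.
    - by right; exists B; split=> //; [left|right].
    - by right; exists A; split=> //; [right|left].
    - right; have [AB|BA] := Ftot _ _ FA FB.
      + by exists B; split=> //; right=> //; apply: AB.
      + by exists A; split=> //; right=> //; apply: BA.
  have DU A x : F A -> D A x -> D U x.
    by move=> FA [Ix|Ax]; [left|right; exists A].
  have Uax : ideal_axiom (fun x => `[< D U x >]).
    split=> [|x y /asboolP Ux /asboolP Uy|a x /asboolP Ux]; apply/asboolP.
    - by left; apply: rpred0.
    - have [[Ix Iy]|[A [FA Ax Ay]]] := cmp2 _ _ Ux Uy; first by left; apply: rpredD.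
      have [K _ AK] := Fadm _ FA; apply: (DU A) => //.
      by apply/AK/rpredD; apply/AK.
    - have [[Ix _]|[A [FA Ax _]]] := cmp2 _ _ Ux Ux; first by left; apply: idealMl.
      have [K _ AK] := Fadm _ FA; apply: (DU A) => //.
      by apply/AK/idealMl/AK.
  exists (Ideal Uax) => [|x]; last by split=> [?|/asboolP]; [apply/asboolP|].
  apply/negP => /asboolP[|[A FA A1]]; first exact/negP/Iproper.
  by have [K /negP K1 AK] := Fadm _ FA; apply/K1/AK; right.
exists J; last by move=> x Ix; apply/AJ; left.
split=> [JT|K JK KT]; first by case/negP: J1; rewrite JT.
apply: idealP => x; apply/idP/idP => [Kx|]; last exact: JK.
apply: contrapT => Jx.
apply: (Amax (fun y => y \in (K : pred S))).
  split; first by move=> y Ay; apply/JK/AJ; right.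
  by move=> KA; apply/Jx/AJ; right; apply: KA.
exists K; first exact: proper_ideal1.
move=> y; split=> [[Iy|//]|Ky]; last by right.
by apply/JK/AJ; left.
Qed.

Section WithMaximal.
Variable m : ideal S.
Hypothesis m_max : unique (@maximal_ideal S) m.

Let m1 : 1 \notin (m : pred S).
Proof. by apply: proper_ideal1; case: m_max => -[]. Qed.

(** A proper ideal lies in some maximal ideal, hence in the only one. *)
Lemma local_ideal_dichotomy I : I = idealT S \/ ideal_sub I m.
Proof.
have [|/exists_maximal_ideal[m' m'_max Im']] := pselect (I = idealT S); first by left.
by right; case: m_max => _ /(_ _ m'_max) ->.
Qed.

Lemma local_unit x : x \notin (m : pred S) -> exists y, x * y = 1.
Proof.
move=> /negP xm; have [xT|xm'] := local_ideal_dichotomy (principal_ideal x).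
  have : 1 \in (principal_ideal x : pred S) by rewrite xT.
  by move=> /asboolP[y ->]; exists y.
by case: xm; apply: xm'; apply/asboolP; exists 1; rewrite mulr1.
Qed.

Lemma local_ideal_meadow : local_meadow (ideal_meadow S).
Proof.
split.
  exists (mzero S) => /mclass_eq[eq0T _]; case/negP: m1.
  have : 1 \in (idealT S : pred S) by [].
  by rewrite -eq0T => /eqP->; apply: rpred0.
have aE (u : ideal_meadow S) : tag (u : mcarrier S) = idealT S -> u = pm_a.
  move=> uT; rewrite [LHS](mclassP u); move: (repr _) => x.
  by rewrite uT; apply/mclass_eq.
move=> u v /mclass_eq[uvT _].
have [|um] := local_ideal_dichotomy (tag (u : mcarrier S)); first by left; apply: aE.
have [|vm] := local_ideal_dichotomy (tag (v : mcarrier S)); first by right; apply: aE.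
by case/negP: m1; apply: (idealD_sub um vm); rewrite uvT.
Qed.

(** A class that is invertible in its own level [S/I] has its inverse there.
    Otherwise [I] and [x] lie in [m], the class stays non-invertible in every
    nonzero level above [S/I], and its only possible inverse is [a]. *)
Definition inverse_spec (u v : mcarrier S) := forall I x, u = mclass I x ->
  (exists2 y, 1 - x * y \in (I : pred S) & v = mclass I y) \/
  [/\ x \in (m : pred S), ideal_sub I m & v = ma S].

Lemma inverse_specP u : exists v, inverse_spec u v.
Proof.
suff [v uv] : exists v, (exists2 y, 1 - repr (tagged u) * y \in (tag u : pred S)
      & v = mclass (tag u) y) \/
    [/\ repr (tagged u) \in (m : pred S), ideal_sub (tag u) m & v = ma S].
  exists v => I x; rewrite {1}(mclassP u) => /mclass_eq[<- ux].
  case: uv => [[y uy ->]|[um Im ->]]; [left|right].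
    exists y => //.
    have -> : 1 - x * y = 1 - repr (tagged u) * y + y * (repr (tagged u) - x) by ring.
    by rewrite rpredD // idealMl.
  split=> //.
  have -> : x = repr (tagged u) - (repr (tagged u) - x) by ring.
  by rewrite rpredB // Im.
set x := repr _; have [uT|um] := local_ideal_dichotomy (tag u).
  by exists (mclass (tag u) 0); left; exists 0; rewrite // uT.
have [xm|/local_unit[y xy]] := boolP (x \in (m : pred S)).
  by exists (ma S); right.
by exists (mclass (tag u) y); left; exists y; rewrite // xy subrr rpred0.
Qed.

Lemma mmulax (u : mcarrier S) : mmul (ma S) u = ma S.
Proof.
by rewrite (mclassP u) mmulE idealDC idealDT; apply/mclass_eq.
Qed.

Lemma mclassT x : mclass (idealT S) x = ma S.
Proof. exact/mclass_eq. Qed.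

Lemma local_common_meadow : is_common_meadow (ideal_meadow S).
Proof.
have [inv invP] := choice inverse_specP.
exists inv; split=> /=.
- move=> u; rewrite (mclassP u); set I := tag u; set x := repr _.
  have [[y xy ->]|[_ _ ->]] := invP _ I x erefl.
    rewrite mmulE mmul0E maddE idealDI ideal0D addr0.
    by apply/mclass_eq; split=> //; rewrite -rpredN opprB.
  by rewrite mmulC mmulax mmul0E maddE ideal0D mclassT.
- move=> u v; rewrite (mclassP u) (mclassP v).
  set I := tag u; set x := repr _; set J := tag v; set x' := repr _.
  have eqE := mmulE I J x x'.
  have [[z xz ->]|[xm IJm ->]] := invP _ _ _ eqE; last first.
    have [[y xy ->]|[_ _ ->]] := invP _ I x erefl; last by rewrite mmulax.
    have [[y' xy' ->]|[_ _ ->]] := invP _ J x' erefl; last by rewrite mmulC mmulax.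
    (* Both factors are invertible, so [x * x'], which lies in [m], is
       invertible modulo an ideal inside [m]. *)
    case/negP: m1.
    have -> : 1 = y * y' * (x * x') + x' * y' * (1 - x * y) + (1 - x' * y') by ring.
    rewrite rpredD //; last by apply/IJm/idealDr.
    by apply: rpredD; apply: idealMl => //; apply/IJm/idealDl.
  (* [x * x'] lies in [m], so it can only be invertible modulo the unit ideal,
     and then its inverse is [a] as well. *)
  have aE : x * x' \in (m : pred S) -> mclass (idealD I J) z = ma S.
    move=> xm; have [->|IJm] := local_ideal_dichotomy (idealD I J).
      exact: mclassT.
    case/negP: m1; have -> : 1 = (1 - x * x' * z) + z * (x * x') by ring.
    by apply: rpredD; [exact: IJm|exact: idealMl].
  have [[y xy ->]|[xm _ ->]] := invP _ I x erefl; last first.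
    by rewrite mmulax aE // mulrC idealMl.
  have [[y' xy' ->]|[xm _ ->]] := invP _ J x' erefl; last first.
    by rewrite mmulC mmulax aE // idealMl.
  rewrite mmulE; apply/mclass_eq; split=> //.
  have -> : z - y * y' = - (y * y') * (1 - x * x' * z)
      + (z * (1 - x * y) + z * x * y * (1 - x' * y')) by ring.
  apply: rpredD; first exact: idealMl.
  by apply: rpredD; apply: idealMl; [exact: idealDl|exact: idealDr].
- move=> u; rewrite (mclassP u) mmul0E maddE ideal0D addr0.
  have [[y xy ->]|[m1T _ _]] := invP _ (tag u) 1 erefl; last by case/negP: m1.
  by apply/mclass_eq; split=> //; rewrite -rpredN opprB -[y]mul1r.
- have [[y]|[_ _ ->]] // := invP _ (ideal0 S) 0 erefl.
  rewrite mul0r subr0 => /eqP S0; case/negP: m1; rewrite S0; exact: rpred0.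
Qed.

End WithMaximal.
End LocalRings.

(** * The meadow of ideals of a finite product of rings *)

Section SurjectiveImage.
Variables (R S : comPzRingType) (f : {rmorphism R -> S}).
Hypothesis f_surj : forall y, exists x, f x = y.
Implicit Types (I J : ideal R).

Lemma ideal_img_axiom I :
  ideal_axiom (fun y => `[< exists2 x, x \in (I : pred R) & f x = y >]).
Proof.
split=> [|_ _ /asboolP[x Ix <-] /asboolP[y Iy <-]|b _ /asboolP[x Ix <-]];
  apply/asboolP.
- by exists 0; rewrite ?rpred0 ?rmorph0.
- by exists (x + y); rewrite ?rpredD ?rmorphD.
- by have [a <-] := f_surj b; exists (a * x); rewrite ?idealMl ?rmorphM.
Qed.

Definition ideal_img I : ideal S := Ideal (ideal_img_axiom I).

Lemma mem_ideal_img I y :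
  y \in (ideal_img I : pred S) <-> exists2 x, x \in (I : pred R) & f x = y.
Proof. by split=> [/asboolP|?]; last apply/asboolP. Qed.

Lemma mem_ideal_img_of I x : x \in (I : pred R) -> f x \in (ideal_img I : pred S).
Proof. by move=> Ix; apply/mem_ideal_img; exists x. Qed.

Lemma ideal_imgD I J : ideal_img (idealD I J) = idealD (ideal_img I) (ideal_img J).
Proof.
apply: idealP => y; apply/idP/idP.
  move=> /mem_ideal_img[_ /mem_idealD[x [x' [Ix Jx' ->]]] <-].
  by rewrite rmorphD; apply/mem_idealD; exists (f x), (f x'); rewrite !mem_ideal_img_of.
move=> /mem_idealD[_ [_ [/mem_ideal_img[x Ix <-] /mem_ideal_img[x' Jx' <-] ->]]].
by rewrite -rmorphD mem_ideal_img_of //; apply/mem_idealD; exists x, x'.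
Qed.

Lemma ideal_img0 : ideal_img (ideal0 R) = ideal0 S.
Proof.
apply: idealP => y; apply/idP/idP => [/mem_ideal_img[x /eqP-> <-]|/eqP->].
  by rewrite rmorph0; apply: rpred0.
by rewrite rpred0.
Qed.

Definition ideal_meadow_map (u : ideal_meadow R) : ideal_meadow S :=
  mclass (ideal_img (tag u)) (f (repr (tagged u))).

Lemma ideal_meadow_mapE I x :
  ideal_meadow_map (mclass I x) = mclass (ideal_img I) (f x).
Proof.
by apply/mclass_eq; split=> //=; rewrite -rmorphB mem_ideal_img_of ?mrepr.
Qed.

Lemma ideal_meadow_map_hom : meadow_hom ideal_meadow_map.
Proof.
split=> [u v|u v|] /=; last by rewrite ideal_meadow_mapE ideal_img0 rmorph1.
- rewrite (mclassP u) (mclassP v) !(maddE, ideal_meadow_mapE).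
  by rewrite ideal_imgD rmorphD.
- rewrite (mclassP u) (mclassP v) !(mmulE, ideal_meadow_mapE).
  by rewrite ideal_imgD rmorphM.
Qed.

End SurjectiveImage.

Section ProductRing.
Variables (R : comPzRingType) (n : nat) (R_ : 'I_n -> comPzRingType).
Variable phi : forall i : 'I_n, {rmorphism R -> R_ i}.
Hypothesis phi_bij : bijective (fun (x : R) (i : 'I_n) => phi i x).

Lemma prod_ring_inj x y : (forall i, phi i x = phi i y) -> x = y.
Proof. by move=> xy; apply: (bij_inj phi_bij); apply: functional_extensionality_dep. Qed.

Lemma prod_ring_surj (y : forall i, R_ i) : exists x, forall i, phi i x = y i.
Proof.
case: phi_bij => g _ gK; exists (g y) => i.
exact: (congr1 (fun z => z i) (gK y)).
Qed.

Lemma coord_surj i (y : R_ i) : exists x, phi i x = y.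
Proof.
have [x xE] := prod_ring_surj (dfwith (fun j => 0) y).
by exists x; rewrite xE dfwith_in.
Qed.

(** An ideal of a finite product is the product of its projections: if [y i]
    in [I] has the same [i]-th coordinate as [x], then [x] is the combination of
    the [y i] with the coordinate idempotents as coefficients. *)
Lemma mem_ideal_coords (I : ideal R) x :
  (forall i, phi i x \in (ideal_img (@coord_surj i) I : pred (R_ i))) ->
  x \in (I : pred R).
Proof.
move=> xI.
have /choice[y yE] i : exists y, y \in (I : pred R) /\ phi i y = phi i x.
  by have /mem_ideal_img[y] := xI i; exists y.
have /choice[e eE] i : exists e, forall j, phi j e = (i == j)%:R.
  exact: (prod_ring_surj (fun j => (i == j)%:R)).
have -> : x = \sum_i e i * y i.
  apply: prod_ring_inj => j; rewrite rmorph_sum (bigD1 j) //= rmorphM eE eqxx.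
  rewrite mul1r (yE j).2 big1 ?addr0 // => i /negPf ij.
  by rewrite rmorphM eE ij mul0r.
by apply: rpred_sum => i _; apply: idealMl; apply: (yE i).1.
Qed.

Lemma ideal_img_inj (I J : ideal R) :
  (forall i, ideal_img (@coord_surj i) I = ideal_img (@coord_surj i) J) -> I = J.
Proof.
move=> IJ; apply: idealP => x; apply/idP/idP => xI; apply: mem_ideal_coords => i.
  by rewrite -IJ mem_ideal_img_of.
by rewrite IJ mem_ideal_img_of.
Qed.

Lemma prod_ideal_axiom (K : forall i, ideal (R_ i)) :
  ideal_axiom (fun x => `[< forall i, phi i x \in (K i : pred (R_ i)) >]).
Proof.
split=> [|x y /asboolP Kx /asboolP Ky|a x /asboolP Kx]; apply/asboolP => i.
- by rewrite rmorph0 rpred0.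
- by rewrite rmorphD; apply: rpredD; [exact: Kx|exact: Ky].
- by rewrite rmorphM; apply: idealMl; exact: Kx.
Qed.

Definition prod_ideal K : ideal R := Ideal (prod_ideal_axiom K).

Lemma ideal_img_prod (K : forall i, ideal (R_ i)) i :
  ideal_img (@coord_surj i) (prod_ideal K) = K i.
Proof.
apply: idealP => y; apply/idP/idP => [/mem_ideal_img[x /asboolP Kx <-]|Ky].
  exact: Kx.
have [x xE] := prod_ring_surj (dfwith (fun j => 0) y).
apply/mem_ideal_img; exists x; last by rewrite xE dfwith_in.
by apply/asboolP => j; rewrite xE; case: dfwithP => // k _; apply: rpred0.
Qed.

Lemma ideal_meadow_prod :
  meadow_iso (ideal_meadow R) (prod_meadow (fun i => ideal_meadow (R_ i))).
Proof.
exists (fun u i => ideal_meadow_map (@coord_surj i) u).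
  split=> [u v|u v|]; apply: functional_extensionality_dep => i;
    have [fD fM f1] := ideal_meadow_map_hom (@coord_surj i).
  - exact: fD.
  - exact: fM.
  - exact: f1.
apply: bijective_of_inj_surj => [u v|w].
  rewrite (mclassP u) (mclassP v) => uv.
  have {}uv i := congr1 (fun h : forall i, ideal_meadow (R_ i) => h i) uv.
  have {}uv i := uv i; apply/mclass_eq; split.
    apply: ideal_img_inj => i.
    by have := uv i; rewrite !ideal_meadow_mapE => /mclass_eq[].
  apply: mem_ideal_coords => i; rewrite rmorphB.
  by have := uv i; rewrite !ideal_meadow_mapE => /mclass_eq[].
pose wt i : ideal (R_ i) := tag (w i : mcarrier (R_ i)).
have [x xE] := prod_ring_surj (fun i => repr (tagged (w i : mcarrier (R_ i)))).
exists (mclass (prod_ideal wt) x); apply: functional_extensionality_dep => i.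
by rewrite ideal_meadow_mapE ideal_img_prod xE [RHS](mclassP (w i)).
Qed.

End ProductRing.

Theorem theorem4p3 (R : comPzRingType) (n : nat) (R_ : 'I_n -> comPzRingType)
    (phi : forall i : 'I_n, {rmorphism R -> R_ i}) :
  artinian R ->
  (forall i, local_ring (R_ i)) ->
  bijective (fun (x : R) (i : 'I_n) => phi i x) ->
  [/\ forall i, is_common_meadow (ideal_meadow (R_ i)) /\
                local_meadow (ideal_meadow (R_ i)),
      meadow_iso (ideal_meadow R) (prod_meadow (fun i => ideal_meadow (R_ i)))
    & forall (s : nat) (N : 'I_s -> commonMeadow),
        (forall j, local_meadow (N j)) ->
        meadow_iso (ideal_meadow R) (prod_meadow (fun j => N j)) ->
        exists (e : s = n) (pi : 'S_n),
          forall j : 'I_s,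
            meadow_iso (N j) (ideal_meadow (R_ (pi (cast_ord e j))))].
Proof.
move=> _ R_local phi_bij.
have M_local i : local_meadow (ideal_meadow (R_ i)).
  by have [m m_max] := R_local i; apply: local_ideal_meadow m_max.
have M_prod := ideal_meadow_prod phi_bij.
split=> // [i|s N N_local N_prod].
  by split=> //; have [m m_max] := R_local i; apply: local_common_meadow m_max.
have [sigma [sigma_bij sigmaE]] := local_factors_unique N_local M_local
  (meadow_iso_trans (meadow_iso_sym N_prod) M_prod).
have e : s = n by have := bij_eq_card sigma_bij; rewrite !card_ord.
have pi_inj : injective (sigma \o cast_ord (esym e)).
  exact: inj_comp (bij_inj sigma_bij) (@cast_ord_inj _ _ _).
by exists e, (perm pi_inj) => j; rewrite permE /= cast_ordK.
Qed.
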